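(* Let $T$ be a (finite) nonabelian simple group generated by two elements $a$ and $b$, where $a$ is an involution and $b$ has order $3$. Consider $T\wr S_{24}$ with $S_{24}$ acting by permuting the $24$ simple direct factors of $N:=T^{24}$. Let $\varphi_0,\rho,\theta\in S_{24}$ be $$\varphi_0:=(1,2)(3,4)(5,6)(7,8)(9,10)(11,12)(13,14)(15,16)(17,18)(19,20)(21,22)(23,24),$$ $$\rho:=(2,4,8)(3,5,7)(10,12,16)(11,13,15)(18,20,24)(19,21,23),$$ $$\theta: i\mapsto i+8 \pmod{24},$$ and let $\varphi_1:=\varphi_0^{\rho}$, $\varphi_2:=\varphi_0^{\rho^2}$ and $\sigma:=\rho\theta$. (Then $\varphi_0,\varphi_1,\varphi_2$ are pairwise commuting involutions, $\sigma$ has order $3$, and $\varphi_i^\sigma=\varphi_{i+1 \bmod 3}$.) Let $$n:=(a,a,a,a,1,1,1,1,b,b,b,b,1,1,1,1,b,b,b,b,1,1,1,1)\in T^{24},$$ let $G:=N\rtimes\langle\varphi_0,\varphi_1,\varphi_2,\sigma\rangle\leq T\wr S_{24}$, so that $G\cong(T^{24}\rtimes C_2^3)\rtimes C_3$, and let $g:=n\sigma\in G$, $S:=\langle\varphi_0,\varphi_1,\varphi_2\rangle$ and $\Gamma:=\mathrm{Cos}(G,S,g)$. Then the following hold: (a) $(\Gamma,G)\in\mathcal{OG}(4)$; (b) $(\Gamma,G)$ is basic of oriented-cycle type.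
   Context: All groups and graphs are finite; graphs are simple and undirected. Points are $\{1,\dots,24\}$. Permutations act on the right (products are composed left to right), $x^y=y^{-1}xy$, and for $m\in T^{24}$ and $x\in S_{24}$, $m^x=x^{-1}mx$ is the tuple whose entry in position $i^x$ is the entry of $m$ in position $i$. For a group $G$, a proper subgroup $S<G$ and $g\in G\setminus S$, the coset graph $\mathrm{Cos}(G,S,g)$ has vertex set $\{Sx: x\in G\}$, with $\{Sx,Sy\}$ an edge iff $xy^{-1}\in SgS$ or $yx^{-1}\in SgS$; $G$ acts on it by right multiplication, and $(\Gamma,G)$ refers to this action (so $(\Gamma,G)\in\mathcal{OG}(4)$ includes that the action is faithful). For $G\le \mathrm{Aut}(\Gamma)$, $\Gamma$ is $G$-oriented if $G$ is transitive on the vertices and on the edges of $\Gamma$ but not on the arcs (ordered pairs of adjacent vertices). $\mathcal{OG}(4)$ is the set of pairs $(\Gamma,G)$ with $\Gamma$ a connected $4$-valent graph, $G\leq \mathrm{Aut}(\Gamma)$, and $\Gamma$ $G$-oriented. For $N\unlhd G$, the $G$-normal quotient $\Gamma_N$ is the graph whose vertices are the $N$-orbits on $V\Gamma$, two distinct $N$-orbits being adjacent iff there is an edge of $\Gamma$ between a vertex of one and a vertex of the other. $\tilde N$ denotes the kernel of the action of $G$ on the set of $N$-orbits. $\mathbf{C}_m$ ($m\ge 3$) is the cycle graph with $m$ vertices. $(\Gamma,G)\in\mathcal{OG}(4)$ is basic if $\Gamma_N$ is isomorphic to $K_1$, $K_2$ or some $\mathbf{C}_m$ ($m\geq 3$)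 for every nontrivial normal subgroup $N$ of $G$. A cyclic normal quotient is a $\Gamma_N$ isomorphic to some $\mathbf{C}_m$, $m\ge3$; it is $G$-oriented if $G/\tilde N\cong C_m$ (cyclic of order $m$) and $G$-unoriented if $G/\tilde N\cong D_m$ (dihedral of order $2m$). Two cyclic normal quotients $\Gamma_M,\Gamma_N$ are independent if $\Gamma_K$, with $K=\tilde M\cap\tilde N$, is not a cycle. $(\Gamma,G)$ is basic of oriented-cycle type if it is basic, has at least one cyclic normal quotient, has no independent cyclic normal quotients, and all its cyclic normal quotients are $G$-oriented. *)

(* Defs.v *)
From mathcomp Require Import all_boot all_fingroup ssralg zmodp all_solvable.

Set Implicit Arguments.
Unset Strict Implicit.
Unset Printing Implicit Defensive.

Local Open Scope group_scope.

(* A simple undirected graph whose vertices form a set in a finite type U, so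
   that coset graphs and quotient graphs can have sets as vertices. *)
Record sgraph (U : finType) := SGraph {
  vset : {set U};
  adj : rel U;
  adj_vset : forall x y, adj x y -> (x \in vset) && (y \in vset);
  adj_sym : symmetric adj;
  adj_irr : irreflexive adj
}.

Definition graph_iso (U U' : finType) (Gam : sgraph U) (Gam' : sgraph U') :=
  exists f : U -> U',
    [/\ {in vset Gam &, injective f},
        f @: vset Gam = vset Gam'
      & {in vset Gam &, forall x y, adj Gam' (f x) (f y) = adj Gam x y}].

Section StandardGraphs.

Variable m : nat.

Definition complete_adj : rel 'I_m := fun i j => i != j.

Lemma complete_adj_vset i j :
  complete_adj i j -> (i \in [set: 'I_m]) && (j \in [set: 'I_m]).
Proof. by rewrite !inE. Qed.

Lemma complete_adj_sym : symmetric complete_adj.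
Proof. by move=> i j; rewrite /complete_adj eq_sym. Qed.

Lemma complete_adj_irr : irreflexive complete_adj.
Proof. by move=> i; rewrite /complete_adj eqxx. Qed.

Definition complete_graph : sgraph 'I_m :=
  SGraph complete_adj_vset complete_adj_sym complete_adj_irr.

(* The conjunct [i != j] matters only for m = 1. *)
Definition cycle_adj : rel 'I_m :=
  fun i j => (i != j) && ((j == ordS i) || (i == ordS j)).

Lemma cycle_adj_vset i j :
  cycle_adj i j -> (i \in [set: 'I_m]) && (j \in [set: 'I_m]).
Proof. by rewrite !inE. Qed.

Lemma cycle_adj_sym : symmetric cycle_adj.
Proof. by move=> i j; rewrite /cycle_adj eq_sym orbC. Qed.

Lemma cycle_adj_irr : irreflexive cycle_adj.
Proof. by move=> i; rewrite /cycle_adj eqxx. Qed.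

Definition cycle_graph : sgraph 'I_m :=
  SGraph cycle_adj_vset cycle_adj_sym cycle_adj_irr.

End StandardGraphs.

Definition is_cycle (U : finType) (Gam : sgraph U) : Prop :=
  exists2 m, 3 <= m & graph_iso Gam (cycle_graph m).

Definition graph_connected (U : finType) (Gam : sgraph U) : Prop :=
  vset Gam != set0 /\ {in vset Gam &, forall x y, connect (adj Gam) x y}.

Definition regular_graph (U : finType) (d : nat) (Gam : sgraph U) : Prop :=
  {in vset Gam, forall x, #|[set y | adj Gam x y]| = d}.

Section OrientedGraphs.

Variables (aT : finGroupType) (U : finType) (to : {action aT &-> U}).
Implicit Types (Gam : sgraph U) (G M N : {group aT}).

Definition edges Gam : {set {set U}} :=
  [set [set x; y] | x in vset Gam, y in vset Gam & adj Gam x y].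

Definition arcs Gam : {set U * U} := [set p | adj Gam p.1 p.2].

Definition arc_transitive Gam G : Prop :=
  {in arcs Gam &, forall p q,
     exists2 g, g \in G & (to p.1 g, to p.2 g) = q}.

(* G, acting via [to], is a subgroup of Aut Gam. *)
Definition acts_as_automorphisms Gam G : Prop :=
  [/\ [acts G, on vset Gam | to],
      [faithful G, on vset Gam | to]
    & {in G, forall g, {in vset Gam &, forall x y,
         adj Gam (to x g) (to y g) = adj Gam x y}}].

Definition oriented Gam G : Prop :=
  [/\ [transitive G, on vset Gam | to],
      [transitive G, on edges Gam | to^*]
    & ~ arc_transitive Gam G].

Definition OG4 Gam G : Prop :=
  [/\ graph_connected Gam, regular_graph 4 Gam,
      acts_as_automorphisms Gam G & oriented Gam G].

Section NormalQuotient.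

Variables (Gam : sgraph U) (N : {group aT}).

Definition quotient_vset : {set {set U}} := [set orbit to N x | x in vset Gam].

Definition quotient_adj : rel {set U} := fun A B =>
  [&& A \in quotient_vset, B \in quotient_vset, A != B &
      [exists x in A, [exists y in B, adj Gam x y]]].

Lemma quotient_adj_vset A B :
  quotient_adj A B -> (A \in quotient_vset) && (B \in quotient_vset).
Proof. by case/and4P=> -> ->. Qed.

Lemma quotient_adj_sym : symmetric quotient_adj.
Proof.
have imp A B : quotient_adj A B -> quotient_adj B A.
  case/and4P=> VA VB neqAB /exists_inP[x Ax /exists_inP[y By xy]].
  apply/and4P; split=> //; first by rewrite eq_sym.
  by apply/exists_inP; exists y => //; apply/exists_inP; exists x;
    rewrite // adj_sym.
by move=> A B; apply/idP/idP; apply: imp.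
Qed.

Lemma quotient_adj_irr : irreflexive quotient_adj.
Proof. by move=> A; rewrite /quotient_adj eqxx /= !andbF. Qed.

Definition normal_quotient : sgraph {set U} :=
  SGraph quotient_adj_vset quotient_adj_sym quotient_adj_irr.

End NormalQuotient.

(* The kernel of the action of G on the set of N-orbits. *)
Definition quotient_kernel Gam G N : {group aT} :=
  'C_G(vset (normal_quotient Gam N) | to^*)%G.

Definition basic Gam G : Prop :=
  OG4 Gam G /\
  forall N, N <| G -> N :!=: 1 ->
    [\/ graph_iso (normal_quotient Gam N) (complete_graph 1),
        graph_iso (normal_quotient Gam N) (complete_graph 2)
      | is_cycle (normal_quotient Gam N)].

Definition cyclic_quotient Gam G N : Prop :=
  N <| G /\ is_cycle (normal_quotient Gam N).

Definition oriented_quotient Gam G N : Prop :=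
  exists m, [/\ 3 <= m, graph_iso (normal_quotient Gam N) (cycle_graph m),
    cyclic (G / quotient_kernel Gam G N)
    & #|G / quotient_kernel Gam G N| = m].

Definition independent_quotients Gam G M N : Prop :=
  ~ is_cycle (normal_quotient Gam
      (quotient_kernel Gam G M :&: quotient_kernel Gam G N)%G).

Definition basic_oriented_cycle_type Gam G : Prop :=
  [/\ basic Gam G,
      exists N, cyclic_quotient Gam G N,
      forall M N, cyclic_quotient Gam G M -> cyclic_quotient Gam G N ->
        ~ independent_quotients Gam G M N
    & forall N, cyclic_quotient Gam G N -> oriented_quotient Gam G N].

End OrientedGraphs.

(* The coset graph Cos(G, S, g), on the right cosets of S in G.  The conjunct
   [X != Y] makes it simple by construction; it is redundant for g outside S,
   since S x = S y gives x y^-1 in S, and S is then disjoint from S g S. *)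
Section CosetGraph.

Variables (wT : finGroupType) (G S : {group wT}) (g : wT).

Definition coset_adj : rel {set wT} := fun X Y =>
  (X != Y) && [exists x in G, [exists y in G,
    [&& X == S :* x, Y == S :* y &
        (x * y^-1 \in S :* g * S) || (y * x^-1 \in S :* g * S)]]].

Lemma coset_adj_vset X Y :
  coset_adj X Y -> (X \in rcosets S G) && (Y \in rcosets S G).
Proof.
case/andP=> _ /exists_inP[x Gx /exists_inP[y Gy /and3P[/eqP-> /eqP-> _]]].
by rewrite -!rcosetE !imset_f.
Qed.

Lemma coset_adj_sym : symmetric coset_adj.
Proof.
have imp X Y : coset_adj X Y -> coset_adj Y X.
  case/andP=> neqXY /exists_inP[x Gx /exists_inP[y Gy /and3P[Xx Yy xy]]].
  rewrite /coset_adj eq_sym neqXY /=.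
  apply/exists_inP; exists y => //; apply/exists_inP; exists x => //.
  by rewrite Xx Yy orbC.
by move=> X Y; apply/idP/idP; apply: imp.
Qed.

Lemma coset_adj_irr : irreflexive coset_adj.
Proof. by move=> X; rewrite /coset_adj eqxx. Qed.

Definition coset_graph : sgraph {set wT} :=
  SGraph coset_adj_vset coset_adj_sym coset_adj_irr.

End CosetGraph.

(* The wreath product T wr S_k, with x in 'S_k moving the entry in position i
   to position x i.  MathComp composes permutations from left to right. *)
Section Wreath.

Variables (T : finGroupType) (k : nat).

Local Notation Tk := {dffun forall i : 'I_k, T}.

Definition tuple_perm (m : Tk) (x : 'S_k) : Tk := [ffun i => m (x^-1 i)].

Lemma tuple_perm1 m : tuple_perm m 1 = m.
Proof. by apply/ffunP=> i; rewrite ffunE invg1 perm1. Qed.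

Lemma tuple_permM m x y :
  tuple_perm m (x * y) = tuple_perm (tuple_perm m x) y.
Proof. by apply/ffunP=> i; rewrite !ffunE invMg permM. Qed.

Definition tuple_action := TotalAction tuple_perm1 tuple_permM.

Lemma tuple_action_is_groupAction :
  is_groupAction [set: Tk] tuple_action.
Proof.
move=> x _; rewrite inE; apply/andP; split.
  by apply/subsetP=> m; rewrite inE.
apply/morphicP=> m p _ _; rewrite !actpermE.
by apply/ffunP=> i; rewrite !ffunE.
Qed.

Definition tuple_groupAction := GroupAction tuple_action_is_groupAction.

Definition wreath : finGroupType := sdprod_by tuple_groupAction.

Definition wtuple (m : Tk) : wreath := sdpair1 tuple_groupAction m.

Definition wperm (x : 'S_k) : wreath := sdpair2 tuple_groupAction x.

Definition base_group : {group wreath} :=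
  (sdpair1 tuple_groupAction @* [set: Tk])%G.

Lemma wtupleJ m x : wtuple m ^ wperm x = wtuple [ffun i => m (x^-1 i)].
Proof. by rewrite /wtuple sdpair_act ?inE. Qed.

End Wreath.

(* The point k of {1, ..., 24} is the element k - 1 of 'I_24. *)
Definition pt (k : nat) : 'I_24 := inord k.-1.

Definition cycle2 (i j : nat) : 'S_24 := tperm (pt i) (pt j).

Definition cycle3 (i j k : nat) : 'S_24 :=
  tperm (pt i) (pt j) * tperm (pt i) (pt k).

Definition phi0 : 'S_24 :=
  cycle2 1 2 * cycle2 3 4 * cycle2 5 6 * cycle2 7 8 * cycle2 9 10
  * cycle2 11 12 * cycle2 13 14 * cycle2 15 16 * cycle2 17 18 * cycle2 19 20
  * cycle2 21 22 * cycle2 23 24.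

Definition rho : 'S_24 :=
  cycle3 2 4 8 * cycle3 3 5 7 * cycle3 10 12 16 * cycle3 11 13 15
  * cycle3 18 20 24 * cycle3 19 21 23.

(* i |-> i + 8 in 'I_24, whose addition is modulo 24. *)
Definition theta : 'S_24 := perm (@GRing.addIr 'I_24 (inord 8)).

Definition phi1 : 'S_24 := phi0 ^ rho.
Definition phi2 : 'S_24 := phi0 ^ (rho ^+ 2).
Definition sigma : 'S_24 := rho * theta.

Section Construction.

Variables (T : finGroupType) (a b : T).

Local Notation wp := (@wperm T 24).

Definition ntuple : {dffun forall i : 'I_24, T} :=
  [ffun i : 'I_24 => nth 1 [:: a; a; a; a; 1; 1; 1; 1;
                                b; b; b; b; 1; 1; 1; 1;
                                b; b; b; b; 1; 1; 1; 1] i].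

Definition GG : {group wreath T 24} :=
  (base_group T 24 <*> <<[set wp phi0; wp phi1; wp phi2; wp sigma]>>)%G.

Lemma GG_sdprod :
  base_group T 24 ><| <<[set wp phi0; wp phi1; wp phi2; wp sigma]>> = GG.
Proof.
have sub : <<[set wp phi0; wp phi1; wp phi2; wp sigma]>>
    \subset sdpair2 (tuple_groupAction T 24) @* setT.
  by rewrite gen_subG !subUset !sub1set !mem_morphim ?inE.
rewrite sdprodEY ?(subset_trans sub (im_sdpair_norm _)) //.
by apply/trivgP; rewrite -(im_sdpair_TI (tuple_groupAction T 24)) setIS.
Qed.

Definition SS : {group wreath T 24} :=
  <<[set wp phi0; wp phi1; wp phi2]>>%G.

Definition gg : wreath T 24 := wtuple ntuple * wp sigma.

Definition Gamma : sgraph {set wreath T 24} := coset_graph GG SS gg.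

End Construction.

(* Main.v *)
Require Import Defs.
From mathcomp Require Import all_boot all_fingroup ssralg zmodp all_solvable.

(** Identify the 24 points with pairs (c, v), c in Z/3 and v in F_2^3, where c
    is the block {8c+1, ..., 8c+8} and v the binary expansion of the position
    in the block.  With e0 = 1, e1 = 3, e2 = 7 a basis of F_2^3, phi_i is the
    translation of v by e_i, and sigma adds 1 to c and maps e0 to e1 to e2 to
    e0.  So P = <phi0, phi1, phi2, sigma> is transitive on the points, and the
    tuple n has entry t_c at (c, v) if v has no e2-component, and 1 otherwise,
    with (t_0, t_1, t_2) = (a, b, b).  Let N be the base group T^24, and
    B = N S, which is normal in G with G / B of order 3, generated by g.

    Local structure.  All edges S x -- S y with y x^-1 in S g S go from a
    coset of B to the next one, so G cannot reverse an edge, and the valency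
    is 2 |S : S :&: S^g|.  As n is invariant under phi0 and phi1 but not under
    phi2, phi0^g = phi1 and phi1^g = phi2, while phi0 is not in S^g; hence this
    index is 2.

    Connectedness, that is <S, g> = G.  Let K be the group of all m in T^24
    lying in H = <S, g>.  The group H induces P on the coordinates, so it
    suffices to work at one base point, (0, e0+e1+e2), which is the point 6.
    The tuple d with d_i = n_i n_(phi2 i)^-1 is in K; it is a^-1 at the base
    point, its conjugate by g is b^-1 there, and so K projects onto T.  Moreover
    g^3 is a tuple in K that is 1 at the base point and at no other point of its
    block, and d^2 is 1 on this block and at no point outside it.  Hence for all
    i and j distinct, K has an element that is 1 at i but not at j.  A subgroup
    of T^24 with these two properties is T^24 [subdirect_unlinked_full]: the
    values at j of the elements of K that are 1 at i form a nontrivial normal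
    subgroup of T, which is T, and as T is perfect, commutators give elements
    that are 1 at all points but j, with any prescribed value at j.

    Normal quotients.  Since T is nonabelian simple and G is transitive on its
    24 copies, every nontrivial normal subgroup M of G contains N
    [base_sub_normal], so M S is B or G.  The orbits of M correspond to the
    cosets of M S, and the quotient is a triangle on which G acts as G / B in
    the first case, a point in the second [coset_graph_basic].  All cyclic
    quotients thus have the kernel B. *)


Set Implicit Arguments.
Unset Strict Implicit.
Unset Printing Implicit Defensive.

Local Open Scope group_scope.

(** * Coset graphs and their normal quotients *)

#[local] Arguments adj : simpl never.
#[local] Arguments vset : simpl never.

Section Graphs.

Variables (U : finType) (Gam : sgraph U).

Lemma graph_iso_complete m : #|vset Gam| = m.+1 ->
    {in vset Gam &, forall x y, adj Gam x y = (x != y)} ->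
  graph_iso Gam (complete_graph m.+1).
Proof.
move=> oV adjV; pose f x : 'I_m.+1 := inord (index x (enum (vset Gam))).
have fK : {in vset Gam, forall x, f x = index x (enum (vset Gam)) :> nat}.
  by move=> x Vx; rewrite inordK // -oV cardE index_mem mem_enum.
have injf : {in vset Gam &, injective f}.
  move=> x y Vx Vy /(congr1 (@nat_of_ord _)); rewrite !fK // => eq_ind.
  rewrite -(nth_index x (_ : x \in enum (vset Gam))) ?mem_enum //.
  by rewrite eq_ind nth_index ?mem_enum.
exists f; split=> //; last first.
  by move=> x y Vx Vy; rewrite adjV // /adj /= /complete_adj (inj_in_eq injf).
have -> : vset (complete_graph m.+1) = [set: 'I_m.+1] by [].
by apply/eqP; rewrite eqEcard subsetT card_in_imset // cardsT card_ord oV /=.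
Qed.

(** The cycle on three vertices is complete. *)
Lemma graph_iso_triangle :
  graph_iso Gam (complete_graph 3) -> graph_iso Gam (cycle_graph 3).
Proof.
case=> f [injf imf adjf]; exists f; split=> // x y Vx Vy.
rewrite -adjf // /adj /= /complete_adj /cycle_adj.
by case: (f x) (f y) => [[|[|[|]]] ?] // [[|[|[|]]] ?].
Qed.

Lemma graph_iso_card (U' : finType) (Gam' : sgraph U') :
  graph_iso Gam Gam' -> #|vset Gam| = #|vset Gam'|.
Proof. by case=> f [injf <- _]; rewrite card_in_imset. Qed.

Lemma cycle_valency m (i : 'I_m) : #|[set j | cycle_adj i j]| <= 2.
Proof.
have sub2 : [set j | cycle_adj i j] \subset [set ordS i; ord_pred i].
  apply/subsetP=> j; rewrite !inE => /andP[_ /orP[-> // | /eqP->]].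
  by rewrite ordSK eqxx orbT.
apply: leq_trans (subset_leq_card sub2) _.
by rewrite cards2; case: (_ != _).
Qed.

(** The orbits of the trivial group are singletons, so that this quotient is
    Gam itself; it is not covered by the condition on nontrivial normal
    subgroups in the definition of a basic pair. *)
Lemma trivial_quotient_not_cycle
    (aT : finGroupType) (to : {action aT &-> U}) x :
  2 < #|[set y | adj Gam x y]| -> ~ is_cycle (normal_quotient to Gam 1%G).
Proof.
move=> val_x [m m3 [f [injf _ adjf]]].
have VX y : y \in vset Gam -> [set y] \in vset (normal_quotient to Gam 1%G).
  by move=> Vy; apply/imsetP; exists y; rewrite //= /orbit imset_set1 act1.
have [y adjxy] : exists y, adj Gam x y.
  case/card_gt0P: (ltn_trans (isT : 0 < 2) val_x) => y.
  by rewrite inE; exists y.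
have /andP[Vx _] := adj_vset adjxy.
suff: #|[set y | adj Gam x y]| <= #|[set j | cycle_adj (f [set x]) j]|.
  by move/(leq_trans val_x); rewrite ltnNge cycle_valency.
rewrite -(@card_in_imset _ _ (fun y => f [set y])).
  apply: subset_leq_card; apply/subsetP=> _ /imsetP[z + ->]; rewrite !inE.
  move=> adjxz; have /andP[_ Vz] := adj_vset adjxz.
  have := adjf _ _ (VX _ Vx) (VX _ Vz); rewrite /adj /= => ->.
  apply/and4P; split; try exact: VX.
    by apply: contraTneq adjxz => /set1_inj->; rewrite adj_irr.
  apply/exists_inP; exists x; rewrite ?set11 //.
  by apply/exists_inP; exists z; rewrite ?set11.
move=> z t; rewrite !inE => /adj_vset/andP[_ Vz] /adj_vset/andP[_ Vt].
by move/(injf _ _ (VX _ Vz) (VX _ Vt))/set1_inj.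
Qed.

End Graphs.

(** The normal subgroup B serves to tell out-neighbours from in-neighbours:
    S g S lies in the coset B g and S g^-1 S in B g^-1, which differ when g^2 is
    not in B. *)
Section CosetGraph.

Variables (gT : finGroupType) (G S B : {group gT}) (g : gT).
Hypotheses (nsBG : B <| G) (sSB : S \subset B) (Gg : g \in G)
  (B'g2 : g ^+ 2 \notin B).

Local Notation D := (S :* g * S).
Local Notation Gam := (coset_graph G S g).

Let nBG : G \subset 'N(B) := normal_norm nsBG.
Let sBG : B \subset G := normal_sub nsBG.
Let sSG : S \subset G := subset_trans sSB sBG.
Let nB x : x \in G -> x \in 'N(B). Proof. exact: subsetP. Qed.
Let inB x : x \in S -> x \in B. Proof. exact: subsetP. Qed.
Let inG x : x \in S -> x \in G. Proof. exact: subsetP. Qed.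

Lemma double_cosetP z :
  reflect (exists2 s, s \in S & exists2 t, t \in S & z = s * g * t) (z \in D).
Proof.
apply: (iffP mulsgP) => [[_ t /rcosetP[s Ss ->] St ->]|[s Ss [t St ->]]].
  by exists s => //; exists t.
by exists (s * g) t; rewrite ?mem_rcoset ?mulgK.
Qed.

Lemma mem_double_coset s t z :
  s \in S -> t \in S -> (s * z * t \in D) = (z \in D).
Proof.
have imp s1 t1 z1 : s1 \in S -> t1 \in S -> z1 \in D -> s1 * z1 * t1 \in D.
  move=> Ss1 St1 /double_cosetP[s2 Ss2 [t2 St2 ->]].
  apply/double_cosetP; exists (s1 * s2); first exact: groupM.
  by exists (t2 * t1); rewrite ?groupM // !mulgA.
move=> Ss St; apply/idP/idP; last exact: imp.
by move/(imp s^-1 t^-1); rewrite !groupV !mulgA mulVg mul1g mulgK; apply.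
Qed.

Lemma coset_double_coset z : z \in D -> coset B z = coset B g.
Proof.
case/double_cosetP=> s Ss [t St ->].
by rewrite coset_kerr ?coset_kerl ?inB.
Qed.

Let B'g : g \notin B.
Proof. by apply: contra B'g2 => Bg; rewrite groupX. Qed.

Lemma double_coset_disj z : z \in D -> (z \notin S) && (z^-1 \notin D).
Proof.
move=> Dz; have Dcz := coset_double_coset Dz; apply/andP; split.
  apply: contra B'g => /inB Bz; apply: coset_idr; first exact: nB.
  by rewrite -Dcz coset_id.
apply: contra B'g2 => /coset_double_coset.
have Gz: z \in G.
  by case/double_cosetP: Dz => s Ss [t St ->]; rewrite !groupM // inG.
rewrite morphV ?nB //= Dcz => eq_gV.
apply: coset_idr; first by rewrite nB ?groupX.
by rewrite morphX ?nB //= expgS expg1 -{1}eq_gV mulVg.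
Qed.

Lemma rcoset_eqE x y : (S :* x == S :* y) = (y * x^-1 \in S).
Proof. by rewrite eq_sym (sameP eqP rcoset_eqP) mem_rcoset. Qed.

Lemma rcosets_G x : x \in G -> S :* x \in rcosets S G.
Proof. by move=> Gx; rewrite -rcosetE imset_f. Qed.

Lemma adj_cosetE x y : x \in G -> y \in G ->
  adj Gam (S :* x) (S :* y) = (x * y^-1 \in D) || (y * x^-1 \in D).
Proof.
move=> Gx Gy; apply/andP/idP=> [[_]|Dxy]; last first.
  split; last first.
    apply/exists_inP; exists x => //; apply/exists_inP; exists y => //.
    by rewrite !eqxx.
  rewrite rcoset_eqE; case/orP: Dxy => /double_coset_disj/andP[S'xy _] //.
  by rewrite -groupV invMg invgK.
case/exists_inP=> x1 Gx1 /exists_inP[y1 Gy1 /and3P[]].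
rewrite !rcoset_eqE => Sx Sy.
have expand (u v u1 v1 : gT) :
    u1 * v1^-1 = (u1 * u^-1) * (u * v^-1) * (v1 * v^-1)^-1.
  by rewrite invMg invgK !mulgA !mulgVK.
by rewrite (expand x y x1 y1) (expand y x y1 x1) !mem_double_coset ?groupV.
Qed.

Let G1 : 1 \in G := group1 G.

(** The cosets S h s x with s in S are those meeting S h S x; for h = g they are
    the out-neighbours of S x, for h = g^-1 the in-neighbours. *)
Lemma mem_rcosets_mul h x y :
  (S :* y \in [set X :* x | X : {set gT} in rcosets (S :* h) S])
    = (y * x^-1 \in S :* h * S).
Proof.
apply/imsetP/mulsgP=> [[_ /rcosetsP[s Ss ->]]|[_ t /rcosetP[s Ss ->] St def_y]].
  rewrite -!rcosetM => /eqP; rewrite eq_sym rcoset_eqE !mulgA => Sy.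
  exists (y * (h * s * x)^-1 * h) s => //; first by rewrite mem_rcoset mulgK.
  by rewrite !invMg !mulgA !mulgVK.
exists (S :* h :* t); first by rewrite -rcosetE imset_f.
rewrite -!rcosetM; apply/eqP; rewrite eq_sym rcoset_eqE.
by rewrite !invMg !mulgA def_y !mulgK.
Qed.

Lemma mem_double_cosetV z : (z^-1 \in D) = (z \in S :* g^-1 * S).
Proof. by rewrite -mem_invg !invMg !invGid invg_set1 mulgA. Qed.

Lemma coset_nbhdE x : x \in G ->
  [set Y | adj Gam (S :* x) Y] =
    [set X :* x | X : {set gT} in rcosets (S :* g) S]
    :|: [set X :* x | X : {set gT} in rcosets (S :* g^-1) S].
Proof.
move=> Gx; apply/setP=> Y; rewrite !inE; apply/idP/idP.
  move=> adjY; case/andP: (adj_vset adjY) => _ /rcosetsP[y Gy defY].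
  move: adjY; rewrite defY adj_cosetE // !mem_rcosets_mul -mem_double_cosetV.
  by rewrite invMg invgK orbC.
move=> nY; have /rcosetsP[y Gy defY] : Y \in rcosets S G.
  by case/orP: (nY) => /imsetP[_ /rcosetsP[s Ss ->] ->];
    rewrite -!rcosetM rcosets_G ?groupM ?groupV // inG.
move: nY; rewrite defY adj_cosetE // !mem_rcosets_mul -mem_double_cosetV.
by rewrite invMg invgK orbC.
Qed.

(** By the orbit-stabilizer theorem for S acting on S g and on S g^-1, whose
    stabilizers S :&: S^g and S :&: S^(g^-1) are conjugate under g. *)
Lemma card_coset_nbhd x : x \in G ->
  #|[set Y | adj Gam (S :* x) Y]| = (#|S : S :&: S :^ g| * 2)%N.
Proof.
move=> Gx; have injx : injective (fun X : {set gT} => X :* x).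
  exact: rcoset_inj.
have out_in_disj : [disjoint [set X :* x | X : {set gT} in rcosets (S :* g) S]
    & [set X :* x | X : {set gT} in rcosets (S :* g^-1) S]].
  rewrite -setI_eq0; apply/set0Pn=> [[Y /setIP[outY]]].
  case/imsetP: (outY) => _ /rcosetsP[s Ss ->] defY; move: outY.
  rewrite defY -!rcosetM !mem_rcosets_mul.
  by rewrite -mem_double_cosetV => /double_coset_disj/andP[_ /negPf->].
rewrite coset_nbhdE // cardsU disjoint_setI0 // cards0 subn0.
rewrite !(card_imset _ injx).
have stabRs h : 'C[S :* h | 'Rs] = S :^ h.
  by rewrite -[in RHS](astab1Rs S) -astab1_act /= rcosetE.
rewrite -!orbitRs !card_orbit !stabRs.
rewrite muln2 -addnn; congr (_ + _)%N; rewrite -!divgS ?subsetIl //.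
by congr (_ %/ _)%N; rewrite -(cardJg _ g) conjIg -conjsgM mulVg conjsg1 setIC.
Qed.

Lemma adj_cosetR h X Y : h \in G -> X \in rcosets S G -> Y \in rcosets S G ->
  adj Gam (X :* h) (Y :* h) = adj Gam X Y.
Proof.
move=> Gh /rcosetsP[x Gx ->] /rcosetsP[y Gy ->].
rewrite -!rcosetM !adj_cosetE ?groupM //.
by rewrite !invMg !mulgA !mulgK.
Qed.

Lemma coset_graph_automorphisms :
  gcore S G = 1 -> acts_as_automorphisms 'Rs Gam G.
Proof.
move=> coreS; split; first exact: actsRs_rcosets.
  by rewrite /faithful /= astabRs_rcosets coreS subsetIr.
by move=> h Gh X Y SX SY; rewrite -[RHS](adj_cosetR Gh) //= !rcosetE.
Qed.

Let Dg : g \in D.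
Proof.
by apply/double_cosetP; exists 1 => //; exists 1; rewrite ?mulg1 ?mul1g.
Qed.

(** The x in G such that S x is in the component of S form a group, since G acts
    by automorphisms; it contains S and g. *)
Lemma coset_graph_connected : G \subset S <*> <[g]> -> graph_connected Gam.
Proof.
move=> genG; split.
  by apply/set0Pn; exists (S :* 1); apply: rcosets_G.
have connR h x y : h \in G -> x \in G -> y \in G ->
    connect (adj Gam) (S :* x) (S :* y) ->
    connect (adj Gam) (S :* (x * h)) (S :* (y * h)).
  move=> Gh Gx Gy /connectP[p + def_y].
  have: S :* x \in rcosets S G by exact: rcosets_G.
  rewrite (rcosetM S y) def_y (rcosetM S x).
  elim: p (S :* x) {def_y} => //= Y p IHp X VX /andP[adjXY pathY].
  have /andP[_ VY] := adj_vset adjXY.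
  apply: connect_trans (IHp Y VY pathY); apply: connect1.
  by rewrite adj_cosetR.
pose C := [set x in G | connect (adj Gam) (S :* 1) (S :* x)].
have gC : group_set C.
  apply/group_setP; split=> [|x y]; first by rewrite inE group1 connect0.
  rewrite !inE => /andP[Gx cx] /andP[Gy cy]; rewrite groupM //=.
  by apply: connect_trans cy _; rewrite -[in S :* y](mul1g y); apply: connR.
have /subsetP GC : G \subset C.
  apply: subset_trans genG _.
  rewrite -[C]/(gval (Group gC)) join_subG cycle_subG.
  apply/andP; split.
    apply/subsetP=> s Ss; rewrite inE inG //= mulg1.
    by rewrite (rcoset_id Ss) connect0.
  rewrite inE Gg connect1 // adj_cosetE // mul1g invg1 mulg1.
  by rewrite Dg orbT.
have conn1 x : x \in G -> connect (adj Gam) (S :* 1) (S :* x).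
  by move/GC; rewrite inE => /andP[].
move=> _ _ /rcosetsP[x Gx ->] /rcosetsP[y Gy ->].
apply: connect_trans (conn1 y Gy).
rewrite (sym_connect_sym (@adj_sym _ Gam)); exact: conn1.
Qed.

Lemma adj_coset_shift h : h \in G -> adj Gam (S :* h) (S :* (g * h)).
Proof. by move=> Gh; rewrite adj_cosetE ?groupM // mulgK Dg orbT. Qed.

(** An element h reversing the edge S -- S g would have g h^-1 and g h in S, and
    then g^2 would be in B. *)
Lemma coset_graph_oriented : oriented 'Rs Gam G.
Proof.
split; first exact: transRs_rcosets.
  pose e0 : {set {set gT}} := [set S :* 1; S :* g].
  have e0J h : ('Rs^*)%act e0 h = [set S :* h; S :* (g * h)].
    by rewrite /= setactE imsetU !imset_set1 /= !rcosetE -!rcosetM mul1g.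
  have edgeP x y : x \in G -> y \in G -> y * x^-1 \in D ->
      [set S :* x; S :* y] \in orbit 'Rs^* G e0.
    move=> Gx Gy /double_cosetP[s Ss [t St def_yx]].
    apply/orbitP; exists (t * x); first by rewrite groupM // inG.
    rewrite e0J; congr [set _; _]; apply/eqP; rewrite rcoset_eqE.
      by rewrite invMg mulgA mulgV mul1g groupV.
    by rewrite !invMg !mulgA def_yx !mulgK.
  have defE : edges Gam = orbit 'Rs^* G e0.
    apply/setP=> e; apply/imset2P/idP=> [[_ Y /rcosetsP[x Gx ->]]|].
      rewrite inE => /andP[/rcosetsP[y Gy ->]]; rewrite adj_cosetE //.
      case/orP=> Dxy ->; last exact: edgeP.
      by rewrite setUC; apply: edgeP.
    case/orbitP=> h Gh <-; rewrite e0J.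
    exists (S :* h) (S :* (g * h)); rewrite ?inE ?rcosets_G ?groupM //=.
    exact: adj_coset_shift.
  apply/imsetP; exists e0; last by [].
  by rewrite defE orbit_refl.
move=> arcT; case: (arcT (S :* 1, S :* g) (S :* g, S :* 1)).
- by rewrite inE /= -{2}[g]mulg1 adj_coset_shift.
- by rewrite inE /= adj_sym -{2}[g]mulg1 adj_coset_shift.
move=> h Gh [] /=; rewrite !rcosetE -!rcosetM mul1g => /eqP + /eqP.
rewrite !rcoset_eqE mul1g => Sgh Sgh1; case/negP: B'g2.
have Bhg := inB Sgh; rewrite -(memJ_norm _ (nB Gh)) conjgE !mulgA mulgVK in Bhg.
have := inB Sgh1; rewrite groupV => Bgh.
have -> : g ^+ 2 = (g * h) * (h^-1 * g) by rewrite mulgA mulgK.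
by rewrite groupM.
Qed.

Theorem coset_graph_OG4 :
    gcore S G = 1 -> G \subset S <*> <[g]> -> #|S : S :&: S :^ g| = 2 ->
  OG4 'Rs Gam G.
Proof.
move=> coreS genG index2; split; last exact: coset_graph_oriented.
- exact: coset_graph_connected.
- by move=> _ /rcosetsP[x Gx ->]; rewrite card_coset_nbhd ?index2.
exact: coset_graph_automorphisms.
Qed.

Section Quotient.

Variable M : {group gT}.
Hypothesis nsMG : M <| G.

Let nM x : x \in G -> x \in 'N(M).
Proof. exact: subsetP (normal_norm nsMG) x. Qed.
Let nMS : S \subset 'N(M) := subset_trans sSG (normal_norm nsMG).
Let sMG : M \subset G := normal_sub nsMG.
Let MG m : m \in M -> m \in G. Proof. exact: subsetP. Qed.

Local Notation orb x := (orbit 'Rs M (S :* x)).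
Local Notation GamM := (normal_quotient 'Rs Gam M).

(** The M-orbit of S x is the set of the S-cosets in (M S) x. *)
Lemma orbit_cosetE x y : x \in G -> y \in G ->
  (orb x == orb y) = (y * x^-1 \in M <*> S).
Proof.
move=> Gx Gy; rewrite (sameP eqP (orbit_eqP (to := 'Rs%act))).
rewrite norm_joinEr //; apply/orbitP/mulsgP=> [[m Mm] | [m s Mm Ss def_yx]].
  rewrite /= rcosetE -rcosetM => /eqP; rewrite rcoset_eqE => Sxm.
  exists (m^-1 ^ y^-1) (x * (y * m)^-1)^-1; last 1 first.
  - by rewrite conjgE invgK invMg !invgK !mulgA mulgVK mulgVK.
  - by rewrite memJ_norm ?groupV ?nM ?groupV.
  by rewrite groupV.
exists (m^-1 ^ y); first by rewrite memJ_norm ?groupV ?nM.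
rewrite /= rcosetE -rcosetM; apply/eqP; rewrite rcoset_eqE conjgE !mulgA mulgV.
rewrite mul1g invMg invgK mulgA -[x * _]invgK invMg invgK def_yx.
by rewrite invMg mulgVK groupV.
Qed.

Lemma orbit_coset_absorb m s x :
  m \in M -> s \in S -> x \in G -> orb (m * s * x) = orb x.
Proof.
move=> Mm Ss Gx; apply/eqP; have Gs := inG Ss; have Gm := MG Mm.
have Gmsx : m * s * x \in G by rewrite !groupM.
rewrite orbit_cosetE // -groupV invMg invgK mulgK.
by rewrite /= norm_joinEr // mem_mulg.
Qed.

Lemma quotient_vsetE : vset GamM = [set orb x | x in G].
Proof.
rewrite /vset /= /quotient_vset; apply/setP=> A; apply/imsetP/imsetP.
  by case=> _ /rcosetsP[x Gx ->] ->; exists x.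
by case=> x Gx ->; exists (S :* x); rewrite ?rcosets_G.
Qed.

Lemma card_quotient_vset : #|vset GamM| = #|G : M <*> S|.
Proof.
pose orbX (X : {set gT}) := orb (repr X).
have orbXE x : x \in G -> orbX ((M <*> S) :* x) = orb x.
  move=> Gx; apply/eqP; have MSx := mem_repr_rcoset (M <*> S)%G x.
  have GMSx : repr ((M <*> S) :* x) \in G.
    move: MSx => /rcosetP[z MSz ->]; rewrite groupM //.
    by apply: subsetP MSz; rewrite join_subG sMG.
  by rewrite eq_sym orbit_cosetE // -mem_rcoset.
have -> : vset GamM = [set orbX X | X in rcosets (M <*> S) G].
  rewrite quotient_vsetE; apply/setP=> A; apply/imsetP/imsetP=> [[x Gx ->]|].
    by exists ((M <*> S) :* x); rewrite ?orbXE // -rcosetE imset_f.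
  by case=> _ /rcosetsP[x Gx ->] ->; exists x; rewrite ?orbXE.
rewrite card_in_imset // => _ _ /rcosetsP[x Gx ->] /rcosetsP[y Gy ->].
rewrite !orbXE // => /eqP; rewrite orbit_cosetE // -mem_rcoset.
by move/rcoset_eqP.
Qed.

(** By [orbit_cosetE], h fixes the orbit of S x iff x h x^-1 is in M S; so the
    kernel is the core of M S in G. *)
Lemma quotient_kernelE :
  M <*> S <| G -> quotient_kernel 'Rs Gam G M :=: M <*> S.
Proof.
move=> nMSG; have nMS' := subsetP (normal_norm nMSG).
have orbJ h x : h \in G -> ('Rs^*)%act (orb x) h = orb (x * h).
  by move=> Gh; rewrite /= setact_orbit (normP (nM Gh)) /= rcosetE -rcosetM.
rewrite /quotient_kernel /= quotient_vsetE; apply/setP=> h; rewrite inE.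
apply/andP/idP=> [[Gh /astabP fixh]|MSh].
  have /eqP := fixh _ (imset_f (fun x => orb x) G1).
  by rewrite orbJ // eq_sym orbit_cosetE ?mul1g // invg1 mulg1.
have Gh : h \in G by apply: subsetP MSh; apply: normal_sub.
split=> //; apply/astabP=> _ /imsetP[x Gx ->]; apply/eqP.
have Gxh : x * h \in G by rewrite groupM.
rewrite orbJ // eq_sym orbit_cosetE //.
have -> : x * h * x^-1 = h ^ x^-1 by rewrite conjgE invgK mulgA.
by rewrite memJ_norm // nMS' ?groupV.
Qed.

End Quotient.

Lemma mem_coset_prime_index z : #|G : B| = 3 -> z \in G -> z \notin B ->
  (z \in B :* g) || (z^-1 \in B :* g).
Proof.
move=> iB Gz B'z; have oGB : #|G / B| = 3 by rewrite card_quotient.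
have Qg : coset B g \in G / B by apply: mem_quotient.
have g3 : coset B g ^+ 3 = 1 by rewrite -oGB expg_cardG.
have ntg : coset B g != 1.
  by apply: contra B'g => /eqP/coset_idr; apply; apply: nB.
have defQ : G / B = <[coset B g]>.
  apply/eqP; rewrite eq_sym eqEcard cycle_subG Qg oGB.
  by rewrite (_ : #|<[_]>| = 3) //; apply: nt_prime_order.
have: coset B z \in <[coset B g]> by rewrite -defQ mem_quotient.
case/cycleP=> i; rewrite (divn_eq i 3) expgD mulnC expgM g3 expg1n mul1g.
have kerP u : u \in G -> coset B u = coset B g -> u \in B :* g.
  by move=> Gu eq_ug; apply/rcoset_kercosetP; rewrite ?nB.
case: (i %% 3)%N (ltn_pmod i (isT : 0 < 3)) => [|[|[|]]] // _ def_z.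
- by case/negP: B'z; apply: coset_idr; rewrite ?nB.
- by rewrite kerP.
apply/orP; right; apply: kerP; rewrite ?groupV // morphV ?nB //= def_z.
by apply: (mulgI (coset B g ^+ 2)); rewrite mulgV -expgSr g3.
Qed.

(** Modulo B the ratio of two representatives is g or g^-1, and there is an
    edge from S x to S g x. *)
Lemma quotient_vset_adj (M : {group gT}) : #|G : B| = 3 -> M <| G ->
    M <*> S = B ->
  {in vset (normal_quotient 'Rs Gam M) &, forall X Y,
     adj (normal_quotient 'Rs Gam M) X Y = (X != Y)}.
Proof.
move=> iB nsMG defB.
have nMS : S \subset 'N(M) := subset_trans sSG (normal_norm nsMG).
have VM x : x \in G -> orbit 'Rs M (S :* x) \in quotient_vset 'Rs Gam M.
  by move=> Gx; apply: imset_f; apply: rcosets_G.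
have shift x y : x \in G -> y \in G -> y * x^-1 \in B :* g ->
    quotient_adj 'Rs Gam M (orbit 'Rs M (S :* x)) (orbit 'Rs M (S :* y)).
  move=> Gx Gy Bg_yx; have Ggx : g * x \in G by rewrite groupM.
  have -> : orbit 'Rs M (S :* y) = orbit 'Rs M (S :* (g * x)).
    apply/eqP; rewrite orbit_cosetE // defB -groupV.
    by move: Bg_yx; rewrite mem_rcoset !invMg invgK !mulgA.
  apply/and4P; split; rewrite ?VM //.
    by rewrite orbit_cosetE // mulgK defB.
  apply/exists_inP; exists (S :* x); first exact: orbit_refl.
  apply/exists_inP; exists (S :* (g * x)); first exact: orbit_refl.
  exact: adj_coset_shift.
move=> _ _ /imsetP[_ /rcosetsP[x Gx ->] ->] /imsetP[_ /rcosetsP[y Gy ->] ->].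
apply/idP/idP=> [|neq_xy]; first by case/and4P.
have Gyx : y * x^-1 \in G by rewrite groupM ?groupV.
have := neq_xy; rewrite orbit_cosetE // defB.
case/(mem_coset_prime_index iB Gyx)/orP => [|]; first exact: shift.
by rewrite invMg invgK adj_sym; apply: shift.
Qed.

Lemma quotient_triangle (M : {group gT}) : #|G : B| = 3 -> M <| G ->
  M <*> S = B -> graph_iso (normal_quotient 'Rs Gam M) (cycle_graph 3).
Proof.
move=> iB nsMG defB; apply/graph_iso_triangle/graph_iso_complete.
  by rewrite card_quotient_vset ?defB.
exact: quotient_vset_adj.
Qed.

(** By minimality of N, the group M S is B or G for every nontrivial normal
    subgroup M, because |G : B| is prime. *)
Theorem coset_graph_basic (N : {group gT}) :
    OG4 'Rs Gam G -> #|G : B| = 3 -> N <*> S = B ->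
    (forall M : {group gT}, M <| G -> M :!=: 1 -> N \subset M) ->
  basic_oriented_cycle_type 'Rs Gam G.
Proof.
move=> ogG iB defB minN.
have MSorG (M : {group gT}) : M <| G -> M :!=: 1 -> M <*> S = B \/ M <*> S = G.
  move=> nsMG ntM; have sBMS : B \subset M <*> S.
    by rewrite -defB genS ?setSU ?minN.
  have sMSG : M <*> S \subset G by rewrite join_subG normal_sub.
  have := Lagrange_index sMSG sBMS; rewrite iB.
  have : #|G : M <*> S| %| 3.
    by rewrite -iB -(Lagrange_index sMSG sBMS) dvdn_mulr.
  rewrite dvdn_divisors // !inE => /orP[]/eqP iMS; rewrite iMS => eq3.
    by right; apply/eqP; rewrite eqEsubset sMSG -indexg_eq1 iMS.
  left; apply/eqP; rewrite eq_sym eqEsubset sBMS -indexg_eq1.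
  by move/eqP: eq3; rewrite -[X in _ == X]muln1 eqn_mul2l.
have quoG (M : {group gT}) : M <| G -> M <*> S = G ->
    #|vset (normal_quotient 'Rs Gam M)| = 1%N.
  by move=> nsMG defG; rewrite card_quotient_vset // defG indexgg.
have nontriv (M : {group gT}) : cyclic_quotient 'Rs Gam G M -> M <*> S = B.
  case=> nsMG cycM; have ntM : M :!=: 1.
    apply/eqP=> M1; have eM1 : M = 1%G by apply: val_inj.
    case: ogG => _ reg4 _ _; rewrite eM1 in cycM.
    apply: trivial_quotient_not_cycle cycM; rewrite (_ : #|_| = 4) //.
    by apply: (reg4 (S :* 1)); apply: rcosets_G.
  have [//|defG] := MSorG M nsMG ntM; case: cycM => m m3 /graph_iso_card.
  by rewrite quoG // cardsT card_ord => m1; rewrite -m1 in m3.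
have kerM (M : {group gT}) : cyclic_quotient 'Rs Gam G M ->
    quotient_kernel 'Rs Gam G M = B.
  move=> cycM; apply: val_inj; rewrite /= quotient_kernelE ?nontriv //.
  by case: cycM.
have triB : graph_iso (normal_quotient 'Rs Gam B) (cycle_graph 3).
  by apply: quotient_triangle => //; apply/joing_idPl.
split.
- split=> // M nsMG ntM; have [MS|MS] := MSorG M nsMG ntM; last first.
    constructor 1; apply: graph_iso_complete; first exact: quoG.
    have /eqP/cards1P[X0 defV] := quoG M nsMG MS.
    by move=> X Y; rewrite defV => /set1P-> /set1P->; rewrite adj_irr eqxx.
  by constructor 3; exists 3 => //; apply: quotient_triangle.
- by exists B; split=> //; exists 3.
- move=> M1 M2 cyc1 cyc2; apply; rewrite !kerM //.
  have -> : (B :&: B)%G = B by apply: val_inj; rewrite /= setIid.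
  by exists 3.
move=> M cycM; exists 3; rewrite kerM // card_quotient // iB; split=> //.
  by apply: quotient_triangle; rewrite ?nontriv //; case: cycM.
by apply: prime_cyclic; rewrite card_quotient // iB.
Qed.

End CosetGraph.

(** * Powers of a nonabelian simple group *)

Section Power.

Variables (T : finGroupType) (I : finType).
Hypotheses (simpleT : simple [set: T]) (nabelT : ~~ abelian [set: T]).

Local Notation TI := {dffun forall i : I, T}.

Lemma simple_normal (V : {group T}) v :
  [set: T] \subset 'N(V) -> v \in V -> v != 1 -> V :=: setT.
Proof.
move=> nVT Vv ntv; have [_ /(_ V)] := simpleP _ simpleT.
case=> [|V1|//]; first by rewrite /normal subsetT.
by case/eqP: ntv; apply/set1P; rewrite -[[set 1]]V1.
Qed.

Lemma der1T : [~: [set: T], [set: T]] = setT.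
Proof.
have [_ /(_ [~: [set: T], [set: T]]%G)] := simpleP _ simpleT.
case=> [|/eqP|//]; first by rewrite /= -derg1 der_normal.
by rewrite /= -derg1 (sameP eqP derG1P) (negPf nabelT).
Qed.

Lemma exists_noncommuting (u : T) : u != 1 -> exists t, [~ u, t] != 1.
Proof.
move=> ntu; apply/existsP; apply: contraR nabelT; rewrite negb_exists.
move=> /forallP cu; have Zu : u \in 'Z([set: T]).
  apply/centerP; split; first exact: in_setT.
  by move=> t _; apply/commgP/eqP; move/negbNE/eqP: (cu t).
apply/center_idP; apply: (simple_normal (V := 'Z(_)%G)) Zu ntu.
exact: gFnorm.
Qed.

Lemma dfung1_full (K : {group TI}) :
  (forall j (t : T), dfung1 (gT := fun=> T) (i := j) t \in K) -> K :=: setT.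
Proof.
move=> K1; apply/eqP; rewrite -subTset; apply/subsetP=> x _.
have -> : x = \prod_i dfung1 (x i).
  apply/ffunP => i; rewrite prodg_ffun (big_only1 i) ?dfung1_id //.
  by move=> j ij _; rewrite dfung1_dflt.
by apply: group_prod => j _; apply: K1.
Qed.

(** The group K is subdirect, and no two of its coordinates are linked by an
    automorphism of T; the second hypothesis is the form of this that is easy
    to check. *)
Section Subdirect.

Variable K : {group TI}.
Hypotheses (subdirK : forall i t, exists2 y : TI, y \in K & y i = t)
  (unlinkedK : forall i j, i != j ->
     exists y : TI, [/\ y \in K, y i = 1 & y j != 1]).

Let slice (r : seq I) : {group TI} :=
  (K :&: setXn_group (fun i => if i \in r then 1 else [set: T])%G)%G.

Let sliceP r (y : TI) :
  reflect (y \in K /\ {in r, forall i, y i = 1}) (y \in slice r).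
Proof.
rewrite inE; apply: (iffP andP) => [[Ky /setXnP y1]|[Ky y1]]; split=> //.
  by move=> i ri; move: (y1 i); rewrite ri => /set1P.
by apply/setXnP=> i; case: ifP => [/y1->|_]; rewrite inE.
Qed.

Let value (j : I) := @dffun_morphism I (fun=> T) j.

Let mem_value r j (y : TI) : y \in slice r -> y j \in value j @* slice r.
Proof. by move=> Sy; apply: (mem_morphim (value j)); rewrite // inE. Qed.

Let value_slice_norm r j : [set: T] \subset 'N(value j @* slice r).
Proof.
apply/subsetP=> t _; have [z Kz <-] := subdirK j t; rewrite inE.
apply/subsetP=> _ /imsetP[_ /morphimP[y _ /sliceP[Ky y1] ->] ->].
rewrite -(morphJ (value j)) ?inE //; apply: mem_value.
apply/sliceP; split=> [|i /y1 yi]; first by rewrite groupJ.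
by rewrite conjgE !mulg_ffun invg_ffun yi mul1g mulVg.
Qed.

Let value_slice1 i j : i != j -> value j @* slice [:: i] = setT.
Proof.
move=> neq_ij; have [y [Ky yi yj]] := unlinkedK neq_ij.
apply: (simple_normal (value_slice_norm [:: i] j)) yj; apply: mem_value.
by apply/sliceP; split=> // k /[1!inE] /eqP->.
Qed.

(** If y is 1 at i and z is 1 on r, then [~ y, z] is 1 on both; the values of
    such commutators at j generate [~: T, T] = T. *)
Let value_slice r j : j \notin r -> value j @* slice r = setT.
Proof.
elim: r => [_|i r IHr]; last rewrite inE negb_or => /andP[neq_ji r'j].
  apply/eqP; rewrite -subTset; apply/subsetP=> t _.
  have [y Ky <-] := subdirK j t; apply: mem_value.
  by apply/sliceP.
apply/eqP; rewrite -subTset.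
apply: (@subset_trans _ _
  (mem [~: value j @* slice [:: i], value j @* slice r])).
  by rewrite value_slice1 1?eq_sym // IHr // der1T.
rewrite gen_subG; apply/subsetP=> _ /imset2P[_ _
  /morphimP[y _ Sy ->] /morphimP[z _ Sz ->] ->].
rewrite -morphR ?inE //; apply: mem_value.
have [Ky y1] := sliceP _ _ Sy; have [Kz z1] := sliceP _ _ Sz.
apply/sliceP; split=> [|k]; first by rewrite groupR.
rewrite commgEl !(mulg_ffun, invg_ffun).
rewrite inE => /orP[/eqP->|/z1 ->].
  by rewrite y1 ?mem_head // !(invg1, mulg1, mul1g) mulVg.
by rewrite !(invg1, mulg1, mul1g) mulVg.
Qed.

Lemma subdirect_unlinked_full : K :=: setT.
Proof.
apply: dfung1_full => j t.
have : t \in value j @* slice (enum (predC1 j)).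
  by rewrite value_slice ?inE // mem_enum inE eqxx.
case/morphimP=> y _ /sliceP[Ky y1] def_t.
rewrite (_ : dfung1 t = y) //; apply/ffunP=> i.
have [<-|neq_ji] := eqVneq j i; first by rewrite dfung1_id.
by rewrite dfung1_dflt // y1 // mem_enum inE eq_sym.
Qed.

End Subdirect.

End Power.

Section WreathProduct.

Variables (T : finGroupType) (k : nat).

Local Notation W := (wreath T k).
Local Notation Tk := {dffun forall i : 'I_k, T}.
Local Notation wt := (@wtuple T k).
Local Notation wp := (@wperm T k).

(** Projection of the wreath product onto the top group; its kernel is the base
    group. *)
Definition wproj (y : W) : 'S_k := (pair_of_sd y).1.

Lemma wprojM : {morph wproj : y z / y * z}.
Proof. by []. Qed.

Canonical wproj_morphism := @Morphism _ _ [set: W] wproj (in2W wprojM).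

Lemma wproj_tuple m : wproj (wt m) = 1.
Proof. by rewrite /wproj val_insubd !inE. Qed.

Lemma wproj_perm x : wproj (wp x) = x.
Proof. by rewrite /wproj val_insubd !inE. Qed.

Lemma wtupleM : {morph wt : m1 m2 / m1 * m2}.
Proof. by move=> m1 m2; rewrite /wtuple morphM ?inE. Qed.

Lemma wtupleV : {morph wt : m / m^-1}.
Proof. by move=> m; rewrite /wtuple morphV ?inE. Qed.

Lemma wpermM : {morph wp : x1 x2 / x1 * x2}.
Proof. by move=> x1 x2; rewrite /wperm morphM ?inE. Qed.

Lemma wpermV : {morph wp : x / x^-1}.
Proof. by move=> x; rewrite /wperm morphV ?inE. Qed.

Lemma wtuple1 : wt 1 = 1. Proof. exact: morph1. Qed.
Lemma wperm1 : wp 1 = 1. Proof. exact: morph1. Qed.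

Lemma wtuple_inj : injective wt.
Proof. by move=> m1 m2 /(injmP (injm_sdpair1 _)); apply; rewrite inE. Qed.

Lemma mem_base m : wt m \in base_group T k.
Proof. by rewrite mem_morphim ?inE. Qed.

Lemma wreathE y : exists m, y = wt m * wp (wproj y).
Proof.
have def_y : y = wp (wproj y) * wt (pair_of_sd y).2 by apply: sdpairE.
exists [ffun i => (pair_of_sd y).2 ((wproj y)^-1^-1 i)].
by rewrite -wtupleJ wpermV conjgE invgK mulgA mulgVK.
Qed.

Lemma mem_baseE y : (y \in base_group T k) = (wproj y == 1).
Proof.
apply/idP/eqP=> [/morphimP[m _ _ ->]|y1]; first exact: wproj_tuple.
by have [m ->] := wreathE y; rewrite y1 wperm1 mulg1 mem_base.
Qed.

(** Conjugation by an element above x moves the coordinate i to x i, up to inner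
    automorphisms of the factors. *)
Lemma wtuple_conj m c x :
  wt m ^ (wt c * wp x) = wt [ffun i => (m ^ c) (x^-1 i)].
Proof. by rewrite conjgM -wtupleJ /conjg !wtupleM wtupleV. Qed.

Hypotheses (simpleT : simple [set: T]) (nabelT : ~~ abelian [set: T]).

(** M meets the base group nontrivially: an element of M that permutes the
    factors nontrivially does not commute with some tuple supported on one
    factor.  If m in M has m_i != 1, commutators with the i-th factor put a
    nontrivial element of this factor in M, hence the whole factor by
    simplicity, and all factors by transitivity. *)
Lemma base_sub_normal (G M : {group W}) :
    base_group T k \subset G ->
    (forall i j, exists2 y, y \in G & wproj y i = j) ->
    M <| G -> M :!=: 1 -> base_group T k \subset M.
Proof.
move=> sbG transG nsMG ntM; have sMG := normal_sub nsMG.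
have wtG m : wt m \in G by apply: (subsetP sbG); apply: mem_base.
have MJ y z : y \in M -> z \in G -> y ^ z \in M.
  by move=> My Gz; rewrite memJ_norm // (subsetP (normal_norm nsMG)).
have [t0 nt_t0] : exists t0 : T, t0 != 1.
  by case/simpleP: simpleT => /trivgPn[t0 _ nt]; exists t0.
have [m [i Mm mi]] : exists m : Tk, exists2 i, wt m \in M & m i != 1.
  have [y My nty] := trivgPn _ ntM; have [c def_y] := wreathE y.
  have [x1 | ] := eqVneq (wproj y) 1.
    have def_yc : y = wt c by rewrite def_y x1 wperm1 mulg1.
    have /existsP[i ci] : [exists i, c i != 1].
      apply: contraR nty; rewrite negb_exists => /forallP c1.
      rewrite def_yc (_ : c = 1) ?wtuple1 //.
      by apply/ffunP=> i; rewrite oneg_ffun; apply/eqP/negbNE.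
    by exists c, i => //; rewrite -def_yc.
  move=> ntx; have /existsP[i xi] : [exists i, wproj y i != i].
    apply: contraR ntx; rewrite negb_exists => /forallP x1.
    by apply/eqP/permP=> i; rewrite perm1; apply/eqP/negbNE.
  (* The commutator of d with y, whose i-th coordinate is t0^-1 as y moves i. *)
  pose d : Tk := dfung1 (gT := fun=> T) (i := i) t0.
  exists (d^-1 * [ffun j => (d ^ c) ((wproj y)^-1 j)]), i.
    rewrite wtupleM wtupleV -wtuple_conj -def_y -[_ * _]/([~ wt d, y]).
    by rewrite commgEr groupM // MJ ?groupV.
  rewrite mulg_ffun invg_ffun dfung1_id ffunE conjgE !mulg_ffun invg_ffun.
  rewrite dfung1_dflt.
    by rewrite mul1g mulVg mulg1 invg_eq1.
  by apply: contra xi => /eqP {1}->; rewrite permKV.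
pose delta j : T -> Tk := @dfung1 _ (fun=> T) j.
pose V j := (dfung1_morphism _ j @*^-1 (sdpair1_morphism _ @*^-1 M))%G.
have memV j t : (t \in V j) = (wt (delta j t) \in M).
  by rewrite !inE.
have V_full j : V j :=: setT -> forall t, wt (delta j t) \in M.
  by move=> Vj t; rewrite -memV Vj inE.
have [t nt_mt] := exists_noncommuting simpleT nabelT mi.
have Vi_full : V i :=: setT.
  apply: (simple_normal simpleT _ _ nt_mt); last first.
    rewrite memV.
    have -> : delta i [~ m i, t] = [~ m, delta i t].
      apply/ffunP=> j; rewrite /commg !conjgE !mulg_ffun !invg_ffun /delta.
      have [<-|neq_ij] := eqVneq i j; first by rewrite !dfung1_id.
      by rewrite !dfung1_dflt // invg1 mul1g mulg1 mulVg.
    rewrite [wt _](morphR (sdpair1_morphism _)) ?inE //=.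
    rewrite commgEl; apply: groupM; rewrite ?groupV //.
    exact: MJ Mm (wtG _).
  apply/subsetP=> u _; rewrite inE; apply/subsetP=> _ /imsetP[v Vv ->].
  rewrite memV /delta (morphJ (dfung1_morphism _ i)) ?inE //=.
  rewrite [wt _](morphJ (sdpair1_morphism _)) ?inE //.
  by move: Vv; rewrite memV => Mv; apply: MJ Mv (wtG _).
have all_delta j u : wt (delta j u) \in M.
  have [y [Gy def_j]] := transG i j; have [c def_y] := wreathE y.
  have -> : delta j u =
      [ffun i1 => (delta i (u ^ (c i)^-1) ^ c) ((wproj y)^-1 i1)].
    apply/ffunP=> i1; rewrite [RHS]ffunE conjgE !mulg_ffun invg_ffun /delta.
    have [<-|neq_ji1] := eqVneq j i1.
      by rewrite -def_j permK !dfung1_id -conjgE conjgKV.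
    rewrite !dfung1_dflt // ?mul1g ?mulVg //.
    by apply: contra neq_ji1 => /eqP def_i; rewrite -def_j def_i permKV.
  by rewrite -wtuple_conj -def_y MJ // V_full.
have -> : base_group T k = wt @: setT :> {set W} by rewrite /= morphimEdom.
apply/subsetP=> _ /imsetP[d _ ->].
suff: d \in (sdpair1_morphism (tuple_groupAction T k) @*^-1 M)%G.
  by rewrite !inE.
rewrite (@dfung1_full _ _ _ _) ?inE // => j u; rewrite !inE; exact: all_delta.
Qed.

End WreathProduct.

(** * The permutations of the 24 points *)

(** Permutations of the points as functions on nat, so that identities between
    them are checked by evaluation; the points are numbered from 0.  An 8-entry
    table acts in the same way on each of the three blocks.  The tables of phi0,
    phi1, phi2 are the maps v |-> v xor 1, v xor 3, v xor 7, and that of rho is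
    the linear map of F_2^3 permuting 1, 3, 7 cyclically. *)
Definition on_blocks (s : seq nat) k := (nth 0 s (k %% 8) + k %/ 8 * 8)%N.
Definition phi0_nat := on_blocks [:: 1; 0; 3; 2; 5; 4; 7; 6]%N.
Definition phi1_nat := on_blocks [:: 3; 2; 1; 0; 7; 6; 5; 4]%N.
Definition phi2_nat := on_blocks [:: 7; 6; 5; 4; 3; 2; 1; 0]%N.
Definition rho_nat := on_blocks [:: 0; 3; 4; 7; 6; 5; 2; 1]%N.
Definition sigma_nat k := ((rho_nat k + 8) %% 24)%N.

Lemma eq_below24 (f h : nat -> nat) :
  all (fun k => f k == h k) (iota 0 24) -> forall i : 'I_24, f i = h i.
Proof. by move=> /allP eq_fh i; apply/eqP/eq_fh; rewrite mem_iota ltn_ord. Qed.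

Definition swap_nat (i j k : nat) :=
  if k == i then j else if k == j then i else k.

Lemma tperm_natE i j (x : 'I_24) : i.-1 < 24 -> j.-1 < 24 ->
  tperm (pt i) (pt j) x = swap_nat i.-1 j.-1 x :> nat.
Proof.
move=> i24 j24; rewrite permE /= /swap_nat /pt -!val_eqE /= !inordK //.
by case: eqP => _; [|case: eqP => _]; rewrite ?inordK.
Qed.

(** Both sides are abstracted over the point first, since [eq_below24] compares
    two functions. *)
Ltac by_table :=
  match goal with |- ?l = ?r =>
    match r with context [nat_of_ord ?i] =>
      match eval pattern (nat_of_ord i) in l with ?f _ =>
        match eval pattern (nat_of_ord i) in r with ?h _ =>
          exact: (@eq_below24 f h isT i)
        end
      end
    end
  end.

Lemma phi0E (i : 'I_24) : phi0 i = phi0_nat i :> nat.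
Proof.
rewrite /phi0 !permM !tperm_natE //.
by_table.
Qed.

Lemma rhoE (i : 'I_24) : rho i = rho_nat i :> nat.
Proof.
rewrite /rho !permM !tperm_natE //.
by_table.
Qed.

(** The conjugate p^q is determined by p^q (q k) = q (p k). *)
Lemma permJ_nat (p q : 'S_24) (f h fJ : nat -> nat) :
    (forall i, p i = f i :> nat) -> (forall i, q i = h i :> nat) ->
    all (fun k => fJ (h k) == h (f k)) (iota 0 24) ->
  forall i, (p ^ q) i = fJ i :> nat.
Proof.
move=> pE qE fJE i; rewrite -(permKV q i) permJ !qE pE.
by rewrite (eq_below24 fJE).
Qed.

Lemma phi1E (i : 'I_24) : phi1 i = phi1_nat i :> nat.
Proof. exact: permJ_nat phi0E rhoE _ i. Qed.

Lemma phi2E (i : 'I_24) : phi2 i = phi2_nat i :> nat.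
Proof.
by rewrite /phi2 expgS expg1 conjgM; apply: permJ_nat phi1E rhoE _ i.
Qed.

Lemma sigmaE (i : 'I_24) : sigma i = sigma_nat i :> nat.
Proof. by rewrite permM permE /= inordK // rhoE. Qed.

Definition perm_natE := (permM, perm1, phi0E, phi1E, phi2E, sigmaE).

Ltac check_perm :=
  apply/permP=> ?; apply: ord_inj; rewrite !perm_natE; by_table.

Lemma phi0_inv : phi0 * phi0 = 1. Proof. check_perm. Qed.
Lemma phi01C : commute phi0 phi1. Proof. check_perm. Qed.
Lemma phi02C : commute phi0 phi2. Proof. check_perm. Qed.
Lemma phi12C : commute phi1 phi2. Proof. check_perm. Qed.
Lemma sigma3 : sigma ^+ 3 = 1. Proof. rewrite !expgS expg0; check_perm. Qed.
Lemma phi0J : phi0 ^ sigma = phi1.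
Proof. apply: (mulgI sigma); rewrite -conjgC; check_perm. Qed.
Lemma phi1J : phi1 ^ sigma = phi2.
Proof. apply: (mulgI sigma); rewrite -conjgC; check_perm. Qed.
Lemma phi2J : phi2 ^ sigma = phi0.
Proof. apply: (mulgI sigma); rewrite -conjgC; check_perm. Qed.

(** The base point, with 0-based number 5 = 1 xor 3 xor 7.  Its orbit under
    sigma is the only one on which the tuple n is 1 throughout. *)
Definition pt6 : 'I_24 := pt 6.

Lemma pt6E : pt6 = 5%N :> nat.
Proof. by rewrite /pt6 /pt inordK. Qed.

(** Exponents (a, b), (c, d) of the words phi0^a phi1^b phi2^c sigma^d. *)
Definition orbit_words : seq ((nat * nat) * (nat * nat)) :=
  let bits := [seq (a, b) | a <- iota 0 2, b <- iota 0 2] in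
  let bit_trits := [seq (c, d) | c <- iota 0 2, d <- iota 0 3] in
  [seq (w1, w2) | w1 <- bits, w2 <- bit_trits].

Definition word_nat (w : (nat * nat) * (nat * nat)) k :=
  iter w.2.2 sigma_nat (iter w.2.1 phi2_nat
    (iter w.1.2 phi1_nat (iter w.1.1 phi0_nat k))).

Lemma permX_nat (p : 'S_24) (f : nat -> nat) e :
  (forall i, p i = f i :> nat) -> forall i, (p ^+ e) i = iter e f i :> nat.
Proof. by move=> pE i; rewrite permX; elim: e => //= e <-; rewrite pE. Qed.

Lemma phi_sigma_transitive (j : 'I_24) : exists a b c d,
  (phi0 ^+ a * phi1 ^+ b * phi2 ^+ c * sigma ^+ d) pt6 = j.
Proof.
have /allP/(_ j) :
    all (fun k => has (fun w => word_nat w 5 == k) orbit_words) (iota 0 24).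
  by vm_compute.
rewrite mem_iota ltn_ord => /(_ isT)/hasP[[[a b] [c d]] _ /eqP def_j].
exists a, b, c, d; apply: ord_inj; rewrite !permM.
by rewrite (permX_nat _ sigmaE) (permX_nat _ phi2E) (permX_nat _ phi1E)
  (permX_nat _ phi0E) pt6E.
Qed.

(** The phi_i preserve the first block, while sigma^2 moves it to the third. *)
Lemma sigma2_notin : sigma ^+ 2 \notin <<[set phi0; phi1; phi2]>>.
Proof.
pose D : {set 'I_24} := [set i : 'I_24 | i < 8].
have sD : <<[set phi0; phi1; phi2]>> \subset 'N(D | 'P).
  rewrite gen_subG; apply/subsetP=> p gen_p; apply/astabsP=> i.
  have [f pE fD] : exists2 f : nat -> nat, forall i, p i = f i :> nat
      & all (fun k => (f k < 8) == (k < 8)) (iota 0 24).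
    move: gen_p; rewrite !inE => /orP[/orP[]|] /eqP->.
    - by exists phi0_nat => //; apply: phi0E.
    - by exists phi1_nat => //; apply: phi1E.
    by exists phi2_nat => //; apply: phi2E.
  move/allP/(_ i): fD; rewrite mem_iota ltn_ord => /(_ isT)/eqP.
  by rewrite !inE /= apermE pE.
apply/negP=> /(subsetP sD)/astabsP/(_ pt6).
by rewrite !inE /= apermE permM !sigmaE pt6E.
Qed.

(** * The group and its generation *)

Lemma wtuple_permM (T : finGroupType) k
    (m1 m2 : {dffun forall i : 'I_k, T}) x y :
  wtuple m1 * wperm T x * (wtuple m2 * wperm T y)
    = wtuple [ffun i => m1 i * m2 (x i)] * wperm T (x * y).
Proof.
have -> : [ffun i => m1 i * m2 (x i)] = m1 * [ffun i => m2 (x^-1^-1 i)].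
  by apply/ffunP=> i; rewrite mulg_ffun !ffunE invgK.
by rewrite wtupleM -wtupleJ wpermM wpermV conjgE invgK !mulgA mulgVK.
Qed.

Section Construction.

Variables (T : finGroupType) (a b : T).
Hypotheses (simpleT : simple [set: T]) (nabelT : ~~ abelian [set: T])
  (genT : <<[set a; b]>> = [set: T]) (ord_a : #[a] = 2) (ord_b : #[b] = 3).

Local Notation W := (wreath T 24).
Local Notation Tk := {dffun forall i : 'I_24, T}.
Local Notation wt := (@wtuple T 24).
Local Notation wp := (@wperm T 24).
Local Notation base := (base_group T 24).
Local Notation S := (SS T).
Local Notation G := (GG T).
Local Notation n := (ntuple a b).
Local Notation g := (gg a b).
Local Notation B := (base <*> S)%G.

Let S0 : wp phi0 \in S. Proof. by rewrite mem_gen // !inE eqxx. Qed.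
Let S1 : wp phi1 \in S. Proof. by rewrite mem_gen // !inE eqxx orbT. Qed.
Let S2 : wp phi2 \in S. Proof. by rewrite mem_gen // !inE eqxx orbT. Qed.

Let nE i : n i = nth 1 [:: a; a; a; a; 1; 1; 1; 1; b; b; b; b; 1; 1; 1; 1;
                           b; b; b; b; 1; 1; 1; 1] i.
Proof. by rewrite ffunE. Qed.

Let sSG : S \subset G.
Proof.
rewrite gen_subG; apply/subsetP=> y gen_y; apply/(subsetP (joing_subr _ _)).
by rewrite mem_gen // inE gen_y.
Qed.

Let sbG : base \subset G := joing_subl _ _.

Let Gsigma : wp sigma \in G.
Proof.
by apply/(subsetP (joing_subr _ _)); rewrite mem_gen // !inE eqxx orbT.
Qed.

Lemma base_group_norm (A : {set W}) : A \subset 'N(base).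
Proof.
apply/subsetP=> y _; rewrite inE; apply/subsetP=> _ /imsetP[z + ->].
rewrite !mem_baseE => /eqP z1.
by rewrite /conjg !wprojM z1 mul1g -wprojM mulVg.
Qed.

Lemma wproj_S y : y \in S ->
  wproj y \in <<[set phi0; phi1; phi2]>> /\ y = wp (wproj y).
Proof.
move=> Sy; have : y \in (sdpair2_morphism (tuple_groupAction T 24) @*
    <<[set phi0; phi1; phi2]>>)%G.
  apply: subsetP Sy; rewrite gen_subG.
  apply/subsetP=> z; rewrite !inE => /orP[/orP[]|]/eqP->;
    by apply: (mem_morphim (sdpair2_morphism _));
      rewrite ?mem_gen // !inE eqxx ?orbT.
by case/morphimP=> x _ Ex ->; rewrite wproj_perm.
Qed.

Let phiJ : [/\ wp phi0 ^ wp sigma = wp phi1, wp phi1 ^ wp sigma = wp phi2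
  & wp phi2 ^ wp sigma = wp phi0].
Proof.
by rewrite /conjg -!wpermV -!wpermM -!/(conjg _ _) phi0J phi1J phi2J.
Qed.

Let sSB : S \subset B := joing_subr _ _.

Lemma B_normal : B <| G.
Proof.
have nBB : B \subset 'N(B) := normG _.
apply/andP; split; first by rewrite join_subG sbG.
rewrite join_subG (subset_trans (joing_subl _ _) nBB) gen_subG.
apply/subsetP=> y gen_y.
have [Sy|] := boolP (y \in S); first by apply/(subsetP nBB)/(subsetP sSB).
case/setUP: gen_y => [gen_y /negP[]|/set1P-> _]; first by rewrite mem_gen.
rewrite -sub1set; apply: normsY; first exact: base_group_norm.
rewrite sub1set inE -genJ gen_subG; apply/subsetP=> _ /imsetP[z gen_z ->].
have [J0 J1 J2] := phiJ; move: gen_z; rewrite !inE.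
by case/orP=> [/orP[]|] /eqP->; rewrite ?J0 ?J1 ?J2.
Qed.

Lemma gg_in_GG : g \in G.
Proof. by rewrite groupM // (subsetP sbG) ?mem_base. Qed.

Let wproj_g : wproj g = sigma.
Proof. by rewrite wprojM wproj_tuple wproj_perm mul1g. Qed.

Lemma wproj_B y : y \in B -> wproj y \in <<[set phi0; phi1; phi2]>>.
Proof.
rewrite /= norm_joinEr ?base_group_norm // => /mulsgP[m s].
rewrite mem_baseE => /eqP m1 /wproj_S[Es _] ->.
by rewrite wprojM m1 mul1g.
Qed.

Lemma gg2_notin_B : g ^+ 2 \notin B.
Proof.
by apply: contra sigma2_notin => /wproj_B; rewrite expgS expg1 wprojM wproj_g.
Qed.

Lemma B_index : #|G : B| = 3.
Proof.
have nBG := normal_norm B_normal; have nBs := subsetP nBG _ Gsigma.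
have defG : G :=: B <*> <[wp sigma]>.
  have sBX : B \subset B <*> <[wp sigma]> := joing_subl _ _.
  apply/eqP; rewrite eqEsubset; apply/andP; split; last first.
    by rewrite join_subG normal_sub ?B_normal // cycle_subG.
  rewrite join_subG (subset_trans _ sBX) ?joing_subl // gen_subG.
  apply/subsetP=> y /setUP[gen_y | /set1P->].
    by apply/(subsetP sBX)/(subsetP sSB); rewrite mem_gen.
  by apply/(subsetP (joing_subr _ _))/cycle_id.
have -> : #|G : B| = #|<[coset B (wp sigma)]>|.
  rewrite -quotient_cycle // -card_quotient // {1}defG.
  by rewrite quotientYidl // cycle_subG.
apply: nt_prime_order => //.
  by rewrite -morphX // -(morphX (sdpair2_morphism _)) ?inE // sigma3 !morph1.
apply: contra gg2_notin_B => /eqP/(coset_idr nBs) Bs.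
by rewrite groupX // groupM // (subsetP (joing_subl _ _)) // mem_base.
Qed.

(** Evaluates the tables at numerals; the entries of n, which lie in an abstract
    group, are then found by simplification. *)
Ltac table_values :=
  repeat match goal with
  | |- context [phi0_nat ?k] => let v := eval compute in (phi0_nat k) in
      change (phi0_nat k) with v
  | |- context [phi1_nat ?k] => let v := eval compute in (phi1_nat k) in
      change (phi1_nat k) with v
  | |- context [phi2_nat ?k] => let v := eval compute in (phi2_nat k) in
      change (phi2_nat k) with v
  | |- context [sigma_nat ?k] => let v := eval compute in (sigma_nat k) in
      change (sigma_nat k) with v
  end.

Let n_phi0 i : n (phi0 i) = n i.
Proof.
rewrite !nE phi0E; move: (nat_of_ord i) (ltn_ord i) => k.
by do 24?[case: k => [|k]; first by table_values].
Qed.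

Let n_phi1 i : n (phi1 i) = n i.
Proof.
rewrite !nE phi1E; move: (nat_of_ord i) (ltn_ord i) => k.
by do 24?[case: k => [|k]; first by table_values].
Qed.

(** wtuple n commutes with the translations that leave n invariant. *)
Let phi_conj_n (p : 'S_24) : (forall i, n (p i) = n i) -> wp p ^ wt n = wp p.
Proof.
move=> n_p; have cpn : wt n ^ wp p = wt n.
  by rewrite wtupleJ; congr wt; apply/ffunP=> i; rewrite ffunE -n_p permKV.
by rewrite conjgE -{2}cpn -conjgC mulKg.
Qed.

(** Two tuples in <S, g>: flip is g phi0 g^-1 phi2^-1, and cube is g^3. *)
Let flip : Tk := [ffun i => n i * (n (phi2 i))^-1].
Let cube : Tk := [ffun i => n i * n (sigma i) * n (sigma (sigma i))].

Let wt_flip : wt flip = wp phi0 ^ g^-1 * (wp phi2)^-1.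
Proof.
have [_ _ <-] := phiJ.
rewrite /gg invMg conjgM conjgK.
rewrite conjgE invgK -mulgA.
have -> : flip = n * [ffun i => n^-1 (phi2^-1^-1 i)].
  by apply/ffunP=> i; rewrite mulg_ffun !ffunE invgK.
by rewrite wtupleM -wtupleJ wtupleV wpermV conjgE invgK !mulgA.
Qed.

Let wt_cube : wt cube = g ^+ 3.
Proof.
rewrite !expgS expg0 mulg1 /gg !wtuple_permM.
have -> : sigma * (sigma * sigma) = 1 by exact: sigma3.
rewrite wperm1 mulg1.
by congr wt; apply/ffunP=> i; rewrite !ffunE mulgA.
Qed.

Let nta : a != 1. Proof. by rewrite -order_gt1 ord_a. Qed.
Let ntb : b != 1. Proof. by rewrite -order_gt1 ord_b. Qed.
Let a2 : a * a = 1. Proof. by rewrite -[a * a]/(a ^+ 2) -ord_a expg_order. Qed.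
Let ntb2 : b * b != 1.
Proof. by rewrite -[b * b]/(b ^+ 2) -order_dvdn ord_b. Qed.
Let ntab : a * b != 1.
Proof.
apply/eqP=> ab1; have := ord_a; rewrite -[a]invgK (_ : a^-1 = b).
  by rewrite orderV ord_b.
by apply: (mulgI a); rewrite mulgV.
Qed.
Let ntab2 : a * b * b != 1.
Proof.
apply/eqP=> ab1; have := ord_a; rewrite -[a]invgK (_ : a^-1 = b ^+ 2).
  by rewrite orderV orderXgcd ord_b.
by apply: (mulgI a); rewrite mulgV expgS expg1 mulgA.
Qed.

Let cube_pt6 : cube pt6 = 1.
Proof. by rewrite ffunE !nE !sigmaE pt6E /= !mulg1. Qed.

(** On the first block cube takes the value a^x b^y, where x in {0, 1} and
    y in {0, 1, 2} count the missing e2-component, resp. the missing e0- and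
    e1-components; this is 1 only if x = y = 0. *)
Let cube_block (i : 'I_24) : i < 8 -> i != pt6 -> cube i != 1.
Proof.
move=> i8 neq_i; have {neq_i} : nat_of_ord i != 5%N.
  by apply: contraNneq neq_i => i5; apply/eqP/ord_inj; rewrite pt6E.
rewrite ffunE !nE !sigmaE; move: (nat_of_ord i) i8 => k.
by do 8?[case: k => [|k]; first by table_values; rewrite /= ?mulg1 ?mul1g].
Qed.

Let flip_pt6 : flip pt6 = a^-1.
Proof. by rewrite ffunE !nE phi2E pt6E /= mul1g. Qed.

(** Outside the first block exactly one of n_i and n_(phi2 i) is b, and the
    other one is 1, so that flip is b or b^-1 there. *)
Let flip2_far (i : 'I_24) : 8 <= i -> (flip * flip) i != 1.
Proof.
move=> i8; rewrite mulg_ffun ffunE !nE phi2E.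
move: (nat_of_ord i) (ltn_ord i) i8 => k.
have ntbV2 : b^-1 * b^-1 != 1 by rewrite -invMg invg_eq1.
by do 24?[case: k => [|k];
  first by table_values; rewrite //= ?invg1 ?mulg1 ?mul1g].
Qed.

(** sigma maps the point numbered 21 from 0 to the base point, and the entry of
    n there is 1. *)
Let flip_gg_pt6 : [ffun i => (flip ^ n) (sigma^-1 i)] pt6 = b^-1.
Proof.
have s_21 : sigma^-1 pt6 = inord 21.
  apply: (@perm_inj _ sigma); apply: ord_inj.
  by rewrite permKV sigmaE inordK ?pt6E.
rewrite ffunE s_21 conjgE !mulg_ffun invg_ffun [flip _]ffunE.
rewrite !nE phi2E inordK //.
by table_values; rewrite /= invg1 mulg1 !mul1g.
Qed.

Local Notation H := (S <*> <[g]>)%G.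

Let sSH : S \subset H := joing_subl _ _.
Let Hg : g \in H.
Proof. by apply/(subsetP (joing_subr _ _))/cycle_id. Qed.

(** Stated for any element s above sigma so as to apply to both G and <S, g>. *)
Lemma wproj_transitive (X : {group W}) s : S \subset X -> s \in X ->
  wproj s = sigma -> forall i j, exists2 y, y \in X & wproj y i = j.
Proof.
move=> /subsetP sSX Xs proj_s.
have to_pt i : exists2 y, y \in X & wproj y pt6 = i.
  have [e0 [e1 [e2 [e3 <-]]]] := phi_sigma_transitive i.
  exists (wp phi0 ^+ e0 * wp phi1 ^+ e1 * wp phi2 ^+ e2 * s ^+ e3).
    by rewrite !groupM // groupX // sSX.
  have projX z e : wproj (z ^+ e) = wproj z ^+ e.
    by elim: e => // e IHe; rewrite !expgS wprojM IHe.
  by rewrite !wprojM !projX !wproj_perm proj_s.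
move=> i j; have [y Xy <-] := to_pt i; have [z Xz <-] := to_pt j.
exists (y^-1 * z); first by rewrite groupM ?groupV.
rewrite wprojM (morphV (wproj_morphism T 24)) ?inE //= permM.
by rewrite permK.
Qed.

Lemma GG_transitive i j : exists2 y, y \in G & wproj y i = j.
Proof. exact: wproj_transitive sSG Gsigma (wproj_perm _ _) i j. Qed.

Lemma base_sub_generated : base \subset H.
Proof.
pose K := (sdpair1_morphism (tuple_groupAction T 24) @*^-1 H)%G.
have memK m : (m \in K) = (wt m \in H) by rewrite !inE.
have Kflip : flip \in K.
  by rewrite memK wt_flip groupM ?groupV ?groupJ ?groupV // (subsetP sSH).
have Kcube : cube \in K by rewrite memK wt_cube groupX.
have transH : forall i j, exists2 y, y \in H & wproj y i = j.
  exact: wproj_transitive sSH Hg wproj_g.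
(* Conjugation by an element of H above p, as a map on tuples. *)
have shift (i j : 'I_24) : exists (c : Tk) (p : 'S_24),
    [/\ p i = j, wt c * wp p \in H
      & forall m, m \in K -> [ffun k => (m ^ c) (p^-1 k)] \in K].
  have [y Hy <-] := transH i j; have [c def_y] := wreathE y.
  exists c, (wproj y); rewrite -def_y; split=> // m; rewrite !memK => Hm.
  by rewrite -wtuple_conj -def_y groupJ.
have valJ (m c : Tk) i : (m ^ c) i = m i ^ c i.
  by rewrite !conjgE !mulg_ffun invg_ffun.
(* The entries of K at the base point include a^-1 and b^-1. *)
have K_pt6 t : exists2 y : Tk, y \in K & y pt6 = t.
  have : t \in @dffun_morphism _ (fun=> T) pt6 @* K.
    apply: subsetP (in_setT t); rewrite -genT gen_subG subUset !sub1set.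
    rewrite -(groupV _ a) -(groupV _ b) -flip_pt6 -flip_gg_pt6.
    apply/andP; split; apply: (mem_morphim (dffun_morphism _ _)) => //;
      rewrite ?in_setT //.
    by rewrite memK -wtuple_conj groupJ // -memK.
  by case/morphimP=> y _ Ky ->; exists y.
suff Kfull : K :=: setT.
  apply/subsetP=> y; rewrite mem_baseE => /eqP y1.
  have [m ->] := wreathE y; rewrite y1 wperm1 mulg1.
  by rewrite -memK Kfull inE.
apply: (subdirect_unlinked_full simpleT nabelT) => [i t|i j neq_ij].
  have [c [p [p_i Hy shiftK]]] := shift pt6 i.
  have [m Km m_pt] := K_pt6 (t ^ (c pt6)^-1).
  exists [ffun k => (m ^ c) (p^-1 k)]; first exact: shiftK.
  by rewrite ffunE -p_i permK valJ m_pt conjgKV.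
have [c [p [p_i Hy shiftK]]] := shift pt6 i.
have neq_pt : p^-1 j != pt6.
  by apply: contra neq_ij => /eqP j_pt; rewrite -p_i -j_pt permKV.
have [m [Km m_pt m_j]] :
    exists m : Tk, [/\ m \in K, m pt6 = 1 & m (p^-1 j) != 1].
  have [block0 | far] := ltnP (p^-1 j) 8.
    by exists cube; split; rewrite ?cube_block.
  exists (flip * flip); split; [exact: groupM | | exact: flip2_far].
  by rewrite mulg_ffun flip_pt6 -invMg a2 invg1.
exists [ffun k => (m ^ c) (p^-1 k)]; split; first exact: shiftK.
  by rewrite ffunE -p_i permK valJ m_pt conj1g.
by rewrite ffunE valJ conjg_eq1.
Qed.

Lemma GG_generated : G \subset H.
Proof.
have sbH := base_sub_generated.
rewrite join_subG sbH gen_subG; apply/subsetP=> y /setUP[gen_y | /set1P->].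
  by apply: (subsetP sSH); rewrite mem_gen.
have -> : wp sigma = (wt n)^-1 * g by rewrite mulKg.
by rewrite groupM ?groupV // (subsetP sbH) ?mem_base.
Qed.

(** A nontrivial core would contain the base group, which meets S trivially. *)
Lemma SS_gcore : gcore S G = 1.
Proof.
apply/eqP; apply: contraT => ntcore.
have sbS : base \subset S.
  apply: subset_trans (gcore_sub S G).
  exact: (base_sub_normal simpleT nabelT sbG GG_transitive (gcore_normal sSG)).
case/simpleP: (simpleT) => /trivgPn[t _ ntt] _.
pose d : Tk := [ffun=> t]; have bd : wt d \in base := mem_base d.
have [_ wt1] := wproj_S (subsetP sbS _ bd).
case/eqP: ntt; have : d = 1.
  by apply: wtuple_inj; rewrite wt1 wproj_tuple wperm1 wtuple1.
by move/ffunP/(_ pt6); rewrite !ffunE.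
Qed.

(** phi1 = phi0^g and phi2 = phi1^g are in S :&: S^g, and together with phi0,
    which is not, they generate the elementary abelian group S. *)
Lemma SS_suborbit : #|S : S :&: S :^ g| = 2.
Proof.
pose K := (S :&: S :^ g)%G.
have wpC p q : commute p q -> commute (wp p) (wp q).
  by move=> cpq; rewrite /commute -!wpermM cpq.
have [C01 C02 C12] := And3 (wpC _ _ phi01C) (wpC _ _ phi02C) (wpC _ _ phi12C).
have abelS : abelian S.
  rewrite abelian_gen; apply/centsP=> x + y; rewrite !inE.
  by case/orP=> [/orP[]|] /eqP->; case/orP=> [/orP[]|] /eqP->;
    first [exact: commute_refl | by [] | exact: commute_sym].
have nsKS : K <| S by rewrite -sub_abelian_normal // subsetIl.
have nKp0 : wp phi0 \in 'N(K) := subsetP (normal_norm nsKS) _ S0.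
have [J0 J1 _] := phiJ.
have K1 : wp phi1 \in K.
  rewrite inE S1 mem_conjg; suff -> : wp phi1 ^ g^-1 = wp phi0 by [].
  by apply: (canLR (conjgK g)); rewrite conjgM phi_conj_n.
have K2 : wp phi2 \in K.
  rewrite inE S2 mem_conjg; suff -> : wp phi2 ^ g^-1 = wp phi1 by [].
  by apply: (canLR (conjgK g)); rewrite conjgM phi_conj_n.
have K'0 : wp phi0 \notin K.
  rewrite inE S0 mem_conjg; apply/negP=> Sp0.
  have Sflip : wt flip \in S by rewrite wt_flip groupM ?groupV.
  have [_ flip1] := wproj_S Sflip; case/eqP: nta; apply: invg_inj.
  have: flip = 1.
    by apply: wtuple_inj; rewrite flip1 wproj_tuple wperm1 wtuple1.
  by move/ffunP/(_ pt6); rewrite flip_pt6 oneg_ffun invg1.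
have defS : S :=: K <*> <[wp phi0]>.
  apply/eqP; rewrite eqEsubset join_subG subsetIl cycle_subG S0 !andbT.
  rewrite gen_subG !subUset !sub1set -cycle_subG joing_subr /=.
  by rewrite !(subsetP (joing_subl _ _)).
rewrite -card_quotient ?normal_norm // {1}defS quotientYidl ?cycle_subG //.
rewrite quotient_cycle //; apply: nt_prime_order => //.
  rewrite -morphX // (_ : wp phi0 ^+ 2 = 1) ?morph1 //.
  by rewrite expgS expg1 -wpermM phi0_inv wperm1.
by apply: contra K'0 => /eqP/coset_idr; apply.
Qed.

End Construction.

Theorem lemma7p13 (T : finGroupType) (a b : T)
  (simpleT : simple [set: T]) (nabelT : ~~ abelian [set: T])
  (genT : <<[set a; b]>> = [set: T]) (ord_a : #[a] = 2) (ord_b : #[b] = 3) :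
  OG4 'Rs (Gamma a b) (GG T) /\
  basic_oriented_cycle_type 'Rs (Gamma a b) (GG T).
Proof.
have ogG : OG4 'Rs (Gamma a b) (GG T).
  exact: (coset_graph_OG4 (B_normal T) (joing_subr _ _) (gg_in_GG a b)
    (gg2_notin_B a b) (SS_gcore simpleT nabelT)
    (GG_generated simpleT nabelT genT ord_a ord_b) (SS_suborbit b ord_a)).
split=> //.
apply: (coset_graph_basic (B_normal T) (joing_subr _ _) (gg_in_GG a b)
  (gg2_notin_B a b) ogG (B_index a b) (N := base_group T 24)) => // M nsMG ntM.
apply: (base_sub_normal simpleT nabelT (joing_subl _ _) _ nsMG ntM).
exact: GG_transitive.
Qed.
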